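(* There exist infinitely many cylindrical algebraic decompositions (CADs) of $\mathbb{R}^4$ that are closure finite but not well-bordered.
   Context: Notation. For a subset $S\subseteq\mathbb{R}^n$, $\mathcal{S}^0(S)$ denotes the ring of continuous semi-algebraic functions $S\to\mathbb{R}$, $\overline{S}$ is the closure of $S$ in the Euclidean topology, and $\partial S=\overline{S}\setminus S$ is the (cell) boundary of $S$ (not the topological frontier). For $f\in\mathcal{S}^0(S)$, the section with base $S$ and bound $f$ is $S\odot\{f\}=\{(\mathbf{x},y)\in\mathbb{R}^{n+1} : \mathbf{x}\in S,\ y=f(\mathbf{x})\}$. For $l\in\mathcal{S}^0(S)\cup\{-\infty\}$ and $u\in\mathcal{S}^0(S)\cup\{+\infty\}$ with $l<u$ on $S$, the sector is $S\odot(l,u)=\{(\mathbf{x},y)\in\mathbb{R}^{n+1} : \mathbf{x}\in S,\ l(\mathbf{x})<y<u(\mathbf{x})\}$. A $k$-tuple $I=(i_1,\ldots,i_k)$ of natural numbers is written as the word $i_1\cdots i_k$, $\varepsilon$ is the empty tuple, and $I:j$ is the tuple $(i_1,\ldots,i_k,j)$. CAD. A cylindrical algebraic decomposition of $\mathbb{R}^n$ (with respect to the fixed variable ordering) is a sequence $\mathscr{C}=(\mathscr{C}_1,\ldots,\mathscr{C}_n)$ such that for each $k\in\{1,\ldots,n\}$ the set $\mathscr{C}_k=\{C_{i_1\cdots i_k} : \forall j\in\{1,\ldots,k\},\ i_j\in\{1,\ldots,2u_{i_1\cdots i_{j-1}}+1\}\}$ is a finite semi-algebraic partition of $\mathbb{R}^k$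 defined inductively as follows. (1) There are $u_\varepsilon\in\mathbb{N}$ and real algebraic numbers $\xi_2<\xi_4<\cdots<\xi_{2u_\varepsilon}$ (none if $u_\varepsilon=0$) such that the cells of $\mathscr{C}_1$ are exactly $C_{2j}=\{\xi_{2j}\}$ for $1\le j\le u_\varepsilon$ and $C_{2j+1}=(\xi_{2j},\xi_{2(j+1)})$ for $0\le j\le u_\varepsilon$, where $\xi_0=-\infty$ and $\xi_{2u_\varepsilon+2}=+\infty$. (2) For each cell $C_I\in\mathscr{C}_k$ with $k<n$ there are $u_I\in\mathbb{N}$ and functions $\xi_{I:2}<\xi_{I:4}<\cdots<\xi_{I:2u_I}$ on $C_I$, all in $\mathcal{S}^0(C_I)$ (none if $u_I=0$), such that the cells of $\mathscr{C}_{k+1}$ are exactly the sets $C_{I:2j}=C_I\odot\{\xi_{I:2j}\}$ for $1\le j\le u_I$ and $C_{I:2j+1}=C_I\odot(\xi_{I:2j},\xi_{I:2(j+1)})$ for $0\le j\le u_I$ (for all $C_I\in\mathscr{C}_k$), where $\xi_{I:0}=-\infty$ and $\xi_{I:2u_I+2}=+\infty$. The CAD $\mathscr{C}$ is identified with the partition $\mathscr{C}_n$ of $\mathbb{R}^n$. A topological ball is a singleton (dimension $0$) or a set homeomorphic to an open ball in $\mathbb{R}^d$ for some $d\ge 1$ (dimension $d$). Every cell of a CAD is a topological ball. Let $\mathscr{D}$ be a finite partition of $\mathbb{R}^n$ all of whose elements are topological balls. $\mathscr{D}$ is closure finite if for every $D\in\mathscr{D}$ there exist $D_1,\ldots,D_K\in\mathscr{D}$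 such that $\overline{D}=\bigcup_{k=1}^K D_k$. $\mathscr{D}$ is well-bordered if for every $D\in\mathscr{D}$ of dimension $d\ge 1$ there exist $D_1,\ldots,D_K\in\mathscr{D}$ of dimension $d-1$ such that $\partial D=\bigcup_{k=1}^K\overline{D_k}$; here $K=0$ (empty union) is allowed, so that a cell with empty boundary satisfies the condition. *)

(* Defs.v *)
From HB Require Import structures.
From mathcomp Require Import all_boot all_order all_algebra.
From mathcomp Require Import all_classical all_reals all_analysis.
From mathcomp Require mpoly.

Set Implicit Arguments.
Unset Strict Implicit.
Unset Printing Implicit Defensive.

Import Order.TTheory GRing.Theory Num.Theory.
Import numFieldNormedType.Exports.

Local Open Scope classical_set_scope.
Local Open Scope ring_scope.

(* R^n is 'rV[R]_n with the product topology of the library, which is the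
   Euclidean topology. *)

Inductive semialgebraic (R : realType) (n : nat) : set 'rV[R]_n -> Prop :=
| semialgebraic_eq0 (p : mpoly.mpoly n R) :
    semialgebraic [set x | mpoly.meval (x ord0) p = 0]
| semialgebraic_gt0 (p : mpoly.mpoly n R) :
    semialgebraic [set x | 0 < mpoly.meval (x ord0) p]
| semialgebraicU (A B : set 'rV[R]_n) :
    semialgebraic A -> semialgebraic B -> semialgebraic (A `|` B)
| semialgebraicC (A : set 'rV[R]_n) :
    semialgebraic A -> semialgebraic (~` A).

(* A point (x, y) of R^(n+1) is a row vector z : 'rV_n.+1 with
   x = col' ord_max z : 'rV_n (z without its last entry) and
   y = z ord0 ord_max. *)

Definition section (R : realType) (n : nat) (S : set 'rV[R]_n)
    (f : 'rV[R]_n -> R) : set 'rV[R]_n.+1 :=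
  [set z | S (col' ord_max z) /\ z ord0 ord_max = f (col' ord_max z)].

Definition sector (R : realType) (n : nat) (S : set 'rV[R]_n)
    (l u : 'rV[R]_n -> \bar R) : set 'rV[R]_n.+1 :=
  [set z | S (col' ord_max z) /\
     (l (col' ord_max z) < (z ord0 ord_max)%:E < u (col' ord_max z))%E].

(* Functions S -> R are represented by total functions of which only the
   restriction to S matters; [section S f] is the graph of that restriction. *)
Definition continuous_semialgebraic (R : realType) (n : nat)
    (S : set 'rV[R]_n) (f : 'rV[R]_n -> R) : Prop :=
  {within S, continuous f} /\ semialgebraic (section S f).

(* For 1 <= j <= u, [xi j] is the function usually written xi_(2j);
   xi_0 = -oo and xi_(2u+2) = +oo are added here. *)
Definition stack_bound (R : realType) (n u : nat) (xi : nat -> 'rV[R]_n -> R)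
    (j : nat) (x : 'rV[R]_n) : \bar R :=
  if j == 0%N then -oo%E else if (j <= u)%N then (xi j x)%:E else +oo%E.

Definition stack (R : realType) (n : nat) (S : set 'rV[R]_n) (u : nat)
    (xi : nat -> 'rV[R]_n -> R) : set (set 'rV[R]_n.+1) :=
  [set section S (xi j) | j in [set j | (1 <= j <= u)%N]] `|`
  [set sector S (stack_bound u xi j) (stack_bound u xi j.+1)
     | j in [set j | (j <= u)%N]].

Definition increasing_on (R : realType) (n : nat) (S : set 'rV[R]_n) (u : nat)
    (xi : nat -> 'rV[R]_n -> R) : Prop :=
  forall i j : nat, (1 <= i)%N -> (i < j)%N -> (j <= u)%N ->
    forall x, S x -> xi i x < xi j x.

(* C_1 is a stack over the one-point space R^0 with constant bounds.  The
   number u_I and the functions xi_I are indexed by the cell C_I itself rather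
   than by the tuple I: distinct tuples give distinct cells, and the tuple of a
   cell is determined by the order of the cells in each stack.
   Only the values C 1, ..., C n matter.  That every C k is a finite
   semi-algebraic partition of R^k follows from the construction. *)
Definition is_cad (R : realType) (n : nat)
    (C : forall k : nat, set (set 'rV[R]_k)) : Prop :=
  [/\ (1 <= n)%N,
      exists (u : nat) (xi : nat -> R),
        [/\ forall j, (1 <= j <= u)%N -> algebraicOver (@ratr R) (xi j),
            increasing_on [set: 'rV[R]_0] u (fun j _ => xi j) &
            C 1%N = stack [set: 'rV[R]_0] u (fun j _ => xi j)] &
      forall k : nat, (1 <= k)%N -> (k < n)%N ->
        exists (u : set 'rV[R]_k -> nat)
               (xi : set 'rV[R]_k -> nat -> 'rV[R]_k -> R),
          (forall S, C k S ->
             (forall j, (1 <= j <= u S)%N ->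
                continuous_semialgebraic S (xi S j)) /\
             increasing_on S (u S) (xi S)) /\
          C k.+1 = \bigcup_(S in C k) stack S (u S) (xi S)].

(* A cylindrical algebraic decomposition is identified with its partition C_n
   of R^n, which determines C_1, ..., C_(n-1) by projection. *)
Definition cad (R : realType) (n : nat) : set (set (set 'rV[R]_n)) :=
  [set P | exists2 C : forall k : nat, set (set 'rV[R]_k),
             is_cad n C & C n = P].

Definition open_euclidean_ball (R : realType) (d : nat) (c : 'rV[R]_d)
    (r : R) : set 'rV[R]_d :=
  [set x | \sum_(i < d) (x ord0 i - c ord0 i) ^+ 2 < r ^+ 2].

Definition homeomorphic (T U : topologicalType) (A : set T) (B : set U) : Prop :=
  exists (f : T -> U) (g : U -> T),
    [/\ {within A, continuous f} /\ {within B, continuous g},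
        (forall x, A x -> B (f x)) /\ (forall y, B y -> A (g y)),
        (forall x, A x -> g (f x) = x) &
        (forall y, B y -> f (g y) = y)].

Definition topological_ball (R : realType) (n : nat) (d : nat)
    (D : set 'rV[R]_n) : Prop :=
  if d == 0%N then exists x, D = [set x]
  else exists (c : 'rV[R]_d) (r : R),
         0 < r /\ homeomorphic D (open_euclidean_ball c r).

Definition cell_boundary (T : topologicalType) (S : set T) : set T :=
  closure S `\` S.

Definition closure_finite (R : realType) (n : nat)
    (P : set (set 'rV[R]_n)) : Prop :=
  forall D, P D ->
    exists (K : nat) (E : 'I_K -> set 'rV[R]_n),
      (forall i, P (E i)) /\ closure D = \bigcup_i E i.

Definition well_bordered (R : realType) (n : nat)
    (P : set (set 'rV[R]_n)) : Prop :=
  forall (D : set 'rV[R]_n) (d : nat), P D -> (1 <= d)%N ->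
    topological_ball d D ->
    exists (K : nat) (E : 'I_K -> set 'rV[R]_n),
      (forall i, P (E i) /\ topological_ball d.-1 (E i)) /\
      cell_boundary D = \bigcup_i closure (E i).

(* Main.v *)
Require Import Defs.
From mathcomp Require Import all_boot all_order all_algebra.
From mathcomp Require Import all_classical all_reals all_analysis.
From mathcomp Require Import ring lra.
From mathcomp Require Import (canonicals) mpoly.

(* For a > 0 consider the graph D of f(x, y, z) = a (y^2 + z^2) / x over the
   half space x > 0.  As x tends to 0, f tends to +oo except at the origin,
   where every value in [0, +oo) is a limit.  Hence D is a 3-cell whose
   boundary is the ray {(0, 0, 0)} x [0, +oo), which contains no 2-cell.  Take
   the CAD whose stacks are cut at 0 over the cell containing the origin, at f
   over {x > 0} in R^3, and nowhere else.  It is closure finite, and D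
   determines a. *)

(** Dimension four gives room for a boundary that is too thin. With y alone, the graph of a y^2 / x
    over the half plane x > 0 is a surface whose boundary is again a ray, of codimension one as
    well-borderedness demands. The extra variable z raises the dimension of the graph but not that
    of the ray. The cuts at 0 over the origin, repeated in every dimension, make this ray a union of
    two cells, the origin and an open half-axis. They also give all cells away from {x > 0} in R^4 a
    uniform description by the index and the sign of the first nonzero coordinate, which an uncut
    stack preserves. Closure finiteness comes from the frontier condition: a closure that meets a
    cell contains it. That the ray holds no 2-cell comes from the intermediate value theorem, since
    the last coordinate is injective on the ray. The parameter is recovered from f(1, 1, 0) = a. *)

Set Implicit Arguments.
Unset Strict Implicit.
Unset Printing Implicit Defensive.

Import Order.TTheory GRing.Theory Num.Theory.
Import numFieldNormedType.Exports.

Local Open Scope classical_set_scope.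
Local Open Scope ring_scope.

(* Coordinates indexed by nat, with the junk value 0 out of range, so that
   col' ord_max preserves them. *)
Definition crd (R : realType) (k : nat) (z : 'rV[R]_k) (n : nat) : R :=
  oapp (z ord0) 0 (insub n).

Definition mkrow (R : realType) (k : nat) (F : nat -> R) : 'rV[R]_k :=
  \row_(i < k) F i.

Lemma crdE (R : realType) (k : nat) (z : 'rV[R]_k) (i : 'I_k) :
  crd z i = z ord0 i.
Proof. by rewrite /crd valK. Qed.

Lemma crd_inj (R : realType) (k : nat) (z t : 'rV[R]_k) :
  (forall n, (n < k)%N -> crd z n = crd t n) -> z = t.
Proof. by move=> e; apply/rowP => i; rewrite -!crdE e. Qed.

Lemma crd0 (R : realType) (k n : nat) : crd (0 : 'rV[R]_k) n = 0.
Proof. by rewrite /crd; case: insub => //= i; rewrite mxE. Qed.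

Lemma crd_mkrow (R : realType) (k : nat) (F : nat -> R) (n : nat) :
  (n < k)%N -> crd (mkrow k F) n = F n.
Proof. by move=> nk; rewrite -[n]/(val (Ordinal nk)) crdE mxE. Qed.

Lemma crd_last (R : realType) (k : nat) (z : 'rV[R]_k.+1) :
  z ord0 ord_max = crd z k.
Proof. by rewrite -(crdE z ord_max). Qed.

Lemma crd_col' (R : realType) (k : nat) (z : 'rV[R]_k.+1) (n : nat) :
  (n < k)%N -> crd (col' ord_max z) n = crd z n.
Proof.
move=> nk; rewrite -[n in LHS]/(val (Ordinal nk)) crdE mxE.
by rewrite -crdE /= /bump leqNgt nk.
Qed.

Lemma crd_continuous (R : realType) (k n : nat) :
  continuous (fun z : 'rV[R]_k => crd z n).
Proof.
rewrite /crd; case: insub => [i|] /= z; last exact: cst_continuous.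
exact: coord_continuous.
Qed.

Lemma cvg_crd (R : realType) (k : nat) (T : Type) (F : set_system T)
    (g : T -> 'rV[R]_k) (q : 'rV[R]_k) : Filter F ->
  (forall n, (n < k)%N -> crd (g x) n @[x --> F] --> crd q n) ->
  g @ F --> q.
Proof.
move=> FF gq; apply/cvg_ballP => e e0.
have : \forall x \near F, forall j : 'I_k, ball (q ord0 j) e (g x ord0 j).
  apply: filter_forall => j.
  have /cvg_ballP/(_ e e0) := gq j (ltn_ord j).
  by apply: filterS => x; rewrite !crdE.
by apply: filterS => x H; split=> // i j; rewrite (ord1 i).
Qed.

Definition pcrd (R : realType) (k n : nat) : mpoly.mpoly k R :=
  oapp (fun i => mpoly.mpolyX R (mpoly.mnm1 i)) 0 (insub n).

Lemma meval_pcrd (R : realType) (k n : nat) (z : 'rV[R]_k) :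
  mpoly.meval (z ord0) (pcrd R k n) = crd z n.
Proof.
rewrite /pcrd /crd; case: insub => [i|] /=; first exact: mpoly.mevalXU.
exact: mpoly.meval0.
Qed.

Lemma semialgebraicI (R : realType) (k : nat) (A B : set 'rV[R]_k) :
  semialgebraic A -> semialgebraic B -> semialgebraic (A `&` B).
Proof.
move=> sA sB; rewrite -[A `&` B]setCK setCI.
by apply: semialgebraicC; apply: semialgebraicU; apply: semialgebraicC.
Qed.

Lemma semialgebraic0 (R : realType) (k : nat) :
  semialgebraic [set (0 : 'rV[R]_k)].
Proof.
(* The coordinates are set to 0 one at a time by binary intersections; for [m = 0] the zero
   polynomial yields the whole space. *)
suff H m : semialgebraic
    [set z : 'rV[R]_k | forall n, (n < m)%N -> crd z n = 0].
  suff -> : [set 0] = [set z : 'rV[R]_k | forall n, (n < k)%N -> crd z n = 0]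
    by exact: H.
  apply/seteqP; split=> z /=; first by move=> -> n _; rewrite crd0.
  by move=> z0; apply: crd_inj => n nk; rewrite z0 // crd0.
elim: m => [|m IH].
  have := semialgebraic_eq0 (0 : mpoly.mpoly k R); congr semialgebraic.
  by apply/seteqP; split=> z //= _; exact: mpoly.meval0.
have := semialgebraicI IH (semialgebraic_eq0 (pcrd R k m)).
congr semialgebraic; apply/seteqP; split=> z /=; rewrite meval_pcrd.
  move=> [H1 H2] n; rewrite ltnS leq_eqVlt => /orP[/eqP -> //|]; exact: H1.
by move=> H; split=> [n nm|]; apply: H => //; exact: ltnW.
Qed.

(** * Cells given by the first nonzero coordinate, and limits along curves *)

Definition sgn (R : realType) (s : bool) : R := if s then -1 else 1.

(* The points whose first nonzero coordinate is the i-th one, with sign s. *)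
Definition lexcell (R : realType) (k i : nat) (s : bool) : set 'rV[R]_k :=
  [set z | (forall j, (j < i)%N -> crd z j = 0) /\ 0 < sgn R s * crd z i].

Definition lexclosed (R : realType) (k i : nat) (s : bool) : set 'rV[R]_k :=
  [set z | (forall j, (j < i)%N -> crd z j = 0) /\ 0 <= sgn R s * crd z i].

Lemma sgn_sqr (R : realType) s : sgn R s * sgn R s = 1.
Proof. by rewrite /sgn; case: s; lra. Qed.

(** Every nontrivial membership in a closure below is shown by a curve that stays in [S] for [d > 0]
    and tends to [q] as [d] decreases to 0. *)
Lemma closure_limit (R : realType) (k : nat) (S : set 'rV[R]_k)
    (g : R -> nat -> R) (q : 'rV[R]_k) :
  (forall d, 0 < d -> S (mkrow k (g d))) ->
  (forall n, (n < k)%N -> continuous_at 0 (fun d => g d n)) ->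
  (forall n, (n < k)%N -> g 0 n = crd q n) ->
  closure S q.
Proof.
move=> Sg cg g0.
apply: (@closed_cvg _ _ (0 : R)^'+ _ (fun d => mkrow k (g d))).
- exact: closed_closure.
- near=> d; apply: subset_closure; apply: Sg; near: d; exact: nbhs_right_gt.
- apply: cvg_crd => n nk; rewrite -g0 //.
  under eq_fun do rewrite crd_mkrow //.
  exact: (cvg_at_right_filter (cg n nk)).
Unshelve. all: by end_near. Qed.

Section real_valued.
Context (R : realType) (T : topologicalType).
Implicit Types (f g : T -> R) (x : T).

Lemma cst_at (c : R) x : continuous_at x (fun _ : T => c).
Proof. exact: cst_continuous. Qed.

Lemma id_at x : continuous_at x (fun z : T => z).
Proof. exact: cvg_id. Qed.

Lemma continuous_atD f g x : continuous_at x f -> continuous_at x g ->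
  continuous_at x (fun z => f z + g z).
Proof. exact: continuousD. Qed.

Lemma continuous_atN f x : continuous_at x f ->
  continuous_at x (fun z => - f z).
Proof. exact: continuousN. Qed.

Lemma continuous_atM f g x : continuous_at x f -> continuous_at x g ->
  continuous_at x (fun z => f z * g z).
Proof. exact: continuousM. Qed.

Lemma continuous_atX f n x : continuous_at x f ->
  continuous_at x (fun z => f z ^+ n).
Proof.
move=> cf; elim: n => [|n IH]; first exact: cst_at.
have -> : (fun z => f z ^+ n.+1) = (fun z => f z * f z ^+ n).
  by apply/funext => z; rewrite exprS.
exact: continuous_atM.
Qed.

Lemma continuous_atV f x : f x != 0 -> continuous_at x f ->
  continuous_at x (fun z => (f z)^-1).
Proof. exact: continuousV. Qed.

End real_valued.

Definition quad (R : realType) (k : nat) (z : 'rV[R]_k) : R :=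
  crd z 1 ^+ 2 + crd z 2 ^+ 2.

Lemma quad_continuous (R : realType) (k : nat) :
  continuous (@quad R k).
Proof.
by move=> z; apply: continuous_atD; apply: continuous_atX; exact: crd_continuous.
Qed.

(** Decomposes algebraic expressions by syntax, leaving the nonvanishing of inverted terms and the
    continuity of unknown functions such as [cos]. *)
Ltac continuity := repeat lazymatch goal with
  | |- continuous_at _ (fun _ => ?c) => exact: cst_at
  | |- continuous_at _ (fun z => z) => exact: id_at
  | |- continuous_at _ (fun z => crd z _) => exact: crd_continuous
  | |- continuous_at _ (fun z => quad z) => exact: quad_continuous
  | |- continuous_at _ (@quad _ _) => exact: quad_continuous
  | |- continuous_at _ (fun z => @?f z + @?g z) =>
      refine (continuous_atD (f:=f) (g:=g) _ _)
  | |- continuous_at _ (fun z => - @?f z) => refine (continuous_atN (f:=f) _)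
  | |- continuous_at _ (fun z => @?f z ^+ _) => refine (continuous_atX (f:=f) _)
  | |- continuous_at _ (fun z => @?f z * @?g z) =>
      refine (continuous_atM (f:=f) (g:=g) _ _)
  | |- continuous_at _ (fun z => (@?f z)^-1) => refine (continuous_atV (f:=f) _ _)
  end.

Lemma closed_le_fun (R : realType) (T : topologicalType) (f g : T -> R) :
  continuous f -> continuous g -> closed [set z | f z <= g z].
Proof.
move=> cf cg; have -> : [set z | f z <= g z] =
    (fun z => g z - f z) @^-1` [set x | 0 <= x].
  by apply/seteqP; split=> z; rewrite /= subr_ge0.
apply: ((continuous_closedP (fun z => g z - f z)).1 _ _ (@closed_ge _ 0)) => z.
by continuity.
Qed.

Lemma closure_lexcell (R : realType) (k i : nat) (s : bool) : (i < k)%N ->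
  closure (lexcell i s : set 'rV[R]_k) = lexclosed i s.
Proof.
move=> ik; apply/seteqP; split.
  have -> : lexclosed i s = [set z | 0 <= sgn R s * crd z i] `&`
      \bigcap_(j in [set j | (j < i)%N]) [set z : 'rV[R]_k | crd z j = 0].
    by apply/seteqP; split=> z [? ?].
  have cl : closed ([set z | 0 <= sgn R s * crd z i] `&`
      \bigcap_(j in [set j | (j < i)%N]) [set z : 'rV[R]_k | crd z j = 0]).
    apply: closedI.
      by apply: closed_le_fun => z; continuity.
    apply: closed_bigI => j _.
    exact: ((continuous_closedP _).1 (@crd_continuous R k j) _ (@closed_eq _ 0)).
  rewrite [X in _ `<=` X](closure_id _).1 //; apply: closureS.
  by move=> z [? ?]; split=> //; exact: ltW.
move=> q [q0 qi].
(* The curve moves [q] along the [i]-th axis in the direction of the sign [s], which adds [d] to the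
   signed coordinate. *)
apply: (@closure_limit _ _ _ (fun d n => crd q n + d * (sgn R s * (n == i)%:R))).
- move=> d d0; split=> [j ji|].
    by rewrite crd_mkrow ?(ltn_trans ji)// q0 // (ltn_eqF ji) !mulr0 addr0.
  rewrite crd_mkrow // eqxx mulr1 mulrDr mulrCA sgn_sqr mulr1.
  exact: ltr_wpDl.
- move=> n nk; by continuity.
- by move=> n nk; rewrite mul0r addr0.
Qed.

(** * The three cells over {x > 0} in R^3 and their closures *)

Lemma quad_ge0 (R : realType) (k : nat) (z : 'rV[R]_k) : 0 <= quad z.
Proof. by rewrite addr_ge0 // sqr_ge0. Qed.

Lemma quad_eq0 (R : realType) (k : nat) (z : 'rV[R]_k) :
  quad z <= 0 -> crd z 1 = 0 /\ crd z 2 = 0.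
Proof. by rewrite /quad; split; nra. Qed.

(** Clearing the denominator of f leaves polynomial conditions that still make sense at x = 0, where
    the closures have to be described. *)
Definition below (R : realType) (a : R) : set 'rV[R]_4 :=
  [set z | 0 < crd z 0 /\ crd z 0 * crd z 3 < a * quad z].

Definition graph (R : realType) (a : R) : set 'rV[R]_4 :=
  [set z | 0 < crd z 0 /\ crd z 0 * crd z 3 = a * quad z].

Definition above (R : realType) (a : R) : set 'rV[R]_4 :=
  [set z | 0 < crd z 0 /\ a * quad z < crd z 0 * crd z 3].

(** For a > 0 the second condition is automatic at x = 0, so the whole hyperplane x = 0 is
    included. *)
Definition belowcl (R : realType) (a : R) : set 'rV[R]_4 :=
  [set z | 0 <= crd z 0 /\ crd z 0 * crd z 3 <= a * quad z].

(** For a > 0, the equation implies w >= 0 where x > 0; at x = 0 it forces y = z = 0 but leaves w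
    free, hence the separate condition on [crd z 3]. *)
Definition graphcl (R : realType) (a : R) : set 'rV[R]_4 :=
  [set z | [/\ 0 <= crd z 0, 0 <= crd z 3 &
               crd z 0 * crd z 3 = a * quad z]].

Definition abovecl (R : realType) (a : R) : set 'rV[R]_4 :=
  [set z | [/\ 0 <= crd z 0, 0 <= crd z 3 &
               a * quad z <= crd z 0 * crd z 3]].

Section closures.
Context (R : realType) (a : R).
Hypothesis a0 : 0 < a.

Lemma closed_belowcl : closed (belowcl a).
Proof.
by apply: closedI; apply: closed_le_fun => z; continuity.
Qed.

Lemma closed_abovecl : closed (abovecl a).
Proof.
have -> : abovecl a = [set z | 0 <= crd z 0] `&` [set z | 0 <= crd z 3] `&`
    [set z | a * quad z <= crd z 0 * crd z 3].
  by apply/seteqP; split=> z [] => [? ? ?|[? ?] ?].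
by do 2?apply: closedI; apply: closed_le_fun => z; continuity.
Qed.

Lemma closed_graphcl : closed (graphcl a).
Proof.
have -> : graphcl a = belowcl a `&` abovecl a.
  apply/seteqP; split=> z; first by move=> [? ? e]; rewrite /belowcl /abovecl /= e.
  by move=> [[? h1] [? ? h2]]; split=> //; apply/eqP; rewrite eq_le h1 h2.
by apply: closedI; [exact: closed_belowcl|exact: closed_abovecl].
Qed.

Lemma closure_below : closure (below a) = belowcl a.
Proof.
apply/seteqP; split.
  rewrite [X in _ `<=` X](closure_id _).1; last exact: closed_belowcl.
  by apply: closureS => z [? ?]; split; exact: ltW.
move=> q [x0 xw]; have [x_gt0|x_le0] := ltP 0 (crd q 0).
  apply: (@closure_limit _ _ _ (fun d => nth 0
    [:: crd q 0; crd q 1; crd q 2; crd q 3 - d])).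
  - move=> d d0; rewrite /below /quad /= !crd_mkrow //=; split=> //.
    by rewrite /quad in xw; nra.
  - by case=> [|[|[|[|]]]] //= _; continuity.
  - by case=> [|[|[|[|]]]] //= _; rewrite subr0.
have {x_le0 x0}x0 : crd q 0 = 0 by lra.
(* With m > w and m > 0, take x = a d^2 m, so that x w < a (d m)^2. Shifting y by d m away from 0,
   in the direction [s], makes y^2 >= (d m)^2. *)
pose m := `|crd q 3| + 1.
have m0 : 0 < m by rewrite ltr_wpDl.
have wm : crd q 3 < m by rewrite /m; have := ler_norm (crd q 3); lra.
pose s : R := if 0 <= crd q 1 then 1 else - 1.
apply: (@closure_limit _ _ _ (fun d => nth 0
  [:: a * d ^+ 2 * m; crd q 1 + s * d * m; crd q 2; crd q 3])).
- move=> d d0; rewrite /below /quad /= !crd_mkrow //=.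
  have dm : 0 < d * m by rewrite mulr_gt0.
  have adm : 0 < a * d ^+ 2 * m by rewrite !mulr_gt0 ?exprn_gt0.
  split=> //.
  apply: (@lt_le_trans _ _ (a * d ^+ 2 * m * m)); first by rewrite ltr_pM2l.
  rewrite -!mulrA ler_pM2l //.
  suff : (d * m) ^+ 2 <= (crd q 1 + s * (d * m)) ^+ 2.
    have := sqr_ge0 (crd q 2); rewrite !expr2 !mulrA; lra.
  by rewrite /s; case: ifPn => [|/negP/negP]; rewrite -?ltNge => ?; nra.
- by case=> [|[|[|[|]]]] //= _; continuity.
- by case=> [|[|[|[|]]]] //= _; rewrite ?expr0n /= ?mulr0 ?mul0r ?addr0.
Qed.

Lemma boundary_point (q : 'rV[R]_4) :
  crd q 0 <= 0 -> abovecl a q -> [/\ crd q 0 = 0, crd q 1 = 0 & crd q 2 = 0].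
Proof.
move=> x_le0 [x0 w0 xw]; have {x_le0 x0}x0 : crd q 0 = 0 by lra.
have [] // : crd q 1 = 0 /\ crd q 2 = 0.
by apply: quad_eq0; move: xw; rewrite x0 mul0r pmulr_rle0.
Qed.

Lemma closure_graph : closure (graph a) = graphcl a.
Proof.
apply/seteqP; split.
  rewrite [X in _ `<=` X](closure_id _).1; last exact: closed_graphcl.
  apply: closureS => z [x0 xw]; split=> //; first exact: ltW.
  by rewrite -(pmulr_rge0 _ x0) xw mulr_ge0 ?quad_ge0 // ltW.
move=> q [x0 w0 xw]; have [x_gt0|x_le0] := ltP 0 (crd q 0).
  exact: subset_closure.
have [q0 q1 q2] : [/\ crd q 0 = 0, crd q 1 = 0 & crd q 2 = 0].
  by apply: boundary_point => //; split=> //; rewrite xw.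
(* The curve lies on the graph because x w' = a d^2 w'^2 = a y^2 with w' = w + d; using w' in place
   of w keeps x positive even when w = 0. *)
apply: (@closure_limit _ _ _ (fun d => nth 0
  [:: a * d ^+ 2 * (crd q 3 + d); d * (crd q 3 + d); 0; crd q 3 + d])).
- move=> d d0; rewrite /graph /quad /= !crd_mkrow //=.
  split; last by rewrite expr0n /=; lra.
  by rewrite !mulr_gt0 ?exprn_gt0 ?ltr_wpDl.
- by case=> [|[|[|[|]]]] //= _; continuity.
- by case=> [|[|[|[|]]]] //= _; rewrite ?expr0n /= ?mulr0 ?mul0r ?addr0.
Qed.

Lemma closure_above : closure (above a) = abovecl a.
Proof.
apply/seteqP; split.
  rewrite [X in _ `<=` X](closure_id _).1; last exact: closed_abovecl.
  apply: closureS => z [x0 xw]; split; [exact: ltW| |exact: ltW].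
  rewrite -(pmulr_rge0 _ x0); apply: le_trans (ltW xw).
  by rewrite mulr_ge0 ?quad_ge0 // ltW.
move=> q qcl; case: (qcl) => x0 w0 xw; have [x_gt0|x_le0] := ltP 0 (crd q 0).
  apply: (@closure_limit _ _ _ (fun d => nth 0
    [:: crd q 0; crd q 1; crd q 2; crd q 3 + d])).
  - move=> d d0; rewrite /above /quad /= !crd_mkrow //=; split=> //.
    by rewrite /quad in xw; nra.
  - by case=> [|[|[|[|]]]] //= _; continuity.
  - by case=> [|[|[|[|]]]] //= _; rewrite addr0.
have [q0 q1 q2] := boundary_point x_le0 qcl.
(* The curve used for the graph, with its last coordinate raised by another [d] to lie strictly
   above. *)
apply: (@closure_limit _ _ _ (fun d => nth 0
  [:: a * d ^+ 2 * (crd q 3 + d); d * (crd q 3 + d); 0; crd q 3 + d + d])).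
- move=> d d0; rewrite /above /quad /= !crd_mkrow //=.
  have xd0 : 0 < a * d ^+ 2 * (crd q 3 + d).
    by rewrite !mulr_gt0 ?exprn_gt0 ?ltr_wpDl.
  split=> //; rewrite expr0n /=; nra.
- by case=> [|[|[|[|]]]] //= _; continuity.
- by case=> [|[|[|[|]]]] //= _; rewrite ?expr0n /= ?mulr0 ?mul0r ?addr0.
Qed.

End closures.

(** * The decomposition and its cells *)

Section cells.
Context (R : realType) (a : R).

(* The stack over S has one cut if S contains the origin or is {x > 0} in R^3,
   and none otherwise. *)
Definition cut_count (k : nat) (S : set 'rV[R]_k) : nat :=
  `[< S 0 \/ (k = 3%N /\ exists2 z, S z & 0 < crd z 0) >].

(** The test on [S] separates the two kinds of cells that carry a cut: the origin, cut at 0, and {x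
    > 0} in R^3, cut at f. *)
Definition cut (k : nat) (S : set 'rV[R]_k) (z : 'rV[R]_k) : R :=
  if `[< exists2 t, S t & 0 < crd t 0 >] then a * quad z / crd z 0 else 0.

(** Starting from the one-point space R^0 lets the first level arise by the same recursion. The
    bounds ignore their index because a stack has at most one cut. *)
Fixpoint cells (k : nat) : set (set 'rV[R]_k) :=
  match k with
  | 0%N => [set [set: 'rV[R]_0]]
  | k'.+1 => \bigcup_(S in @cells k') stack S (cut_count S) (fun _ => cut S)
  end.
Arguments cells k : clear implicits.

Lemma stack_nocut (k : nat) (T : set 'rV[R]_k) xi :
  stack T 0 xi = [set [set z | T (col' ord_max z)]].
Proof.
have e : sector T (stack_bound 0 xi 0) (stack_bound 0 xi 1) =
    [set z | T (col' ord_max z)].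
  by apply/seteqP; split=> z; [case|]; rewrite /sector /stack_bound /= ?ltNyr ?ltry.
rewrite /stack; apply/seteqP; split=> S.
  case=> [[j /=]|[j /=]]; first by case: j.
  by rewrite leqn0 => /eqP -> <-.
by move=> ->; right; exists 0%N.
Qed.

Lemma stack_onecut (k : nat) (T : set 'rV[R]_k) (f : 'rV[R]_k -> R) :
  stack T 1 (fun _ => f) = [set S | [\/ S = section T f,
    S = [set z | T (col' ord_max z) /\ crd z k < f (col' ord_max z)] |
    S = [set z | T (col' ord_max z) /\ f (col' ord_max z) < crd z k]]].
Proof.
have e0 : sector T (stack_bound 1 (fun _ => f) 0) (stack_bound 1 (fun _ => f) 1) =
    [set z | T (col' ord_max z) /\ crd z k < f (col' ord_max z)].
  by apply/seteqP; split=> z; rewrite /sector /stack_bound /= crd_last ltNyr lte_fin.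
have e1 : sector T (stack_bound 1 (fun _ => f) 1) (stack_bound 1 (fun _ => f) 2) =
    [set z | T (col' ord_max z) /\ f (col' ord_max z) < crd z k].
  by apply/seteqP; split=> z; rewrite /sector /stack_bound /= crd_last ltry andbT lte_fin.
rewrite /stack; apply/seteqP; split=> S.
  case=> [[j /= _ <-]|[[|[|//]] _ <-]]; first exact: Or31.
  - by rewrite e0; exact: Or32.
  - by rewrite e1; exact: Or33.
case=> ->; first by left; exists 1%N.
  by right; exists 0%N.
by right; exists 1%N.
Qed.

Lemma lexcellS (k i : nat) s : (i < k)%N ->
  [set z : 'rV[R]_k.+1 | lexcell i s (col' ord_max z)] = lexcell i s.
Proof.
move=> ik; apply/seteqP; split=> z [z0 zi]; split; move: zi; rewrite ?crd_col' //;
by move=> _ j ji; have := z0 j ji; rewrite crd_col' // (ltn_trans ji).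
Qed.

Lemma col'_eq0 (k : nat) (z : 'rV[R]_k.+1) :
  col' ord_max z = 0 <-> (forall j, (j < k)%N -> crd z j = 0).
Proof.
split=> [e j jk|e]; first by rewrite -crd_col' // e crd0.
by apply: crd_inj => n nk; rewrite crd_col' // crd0 e.
Qed.

Lemma section0 (k : nat) (f : 'rV[R]_k -> R) : f 0 = 0 ->
  section [set 0] f = [set (0 : 'rV[R]_k.+1)].
Proof.
move=> f0; apply/seteqP; split=> z; last first.
  move=> ->; have e : col' ord_max (0 : 'rV[R]_k.+1) = 0.
    by apply/col'_eq0 => j _; rewrite crd0.
  by split=> //=; rewrite e mxE.
move=> [/= e]; rewrite e f0 crd_last => zk; apply: crd_inj => n.
rewrite crd0 ltnS leq_eqVlt => /orP[/eqP -> //|nk].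
exact: (col'_eq0 z).1.
Qed.

Lemma notin_lexcell0 (k i : nat) s : ~ lexcell i s (0 : 'rV[R]_k).
Proof. by case=> _; rewrite crd0 mulr0 ltxx. Qed.

Lemma cut_count0 (k : nat) : cut_count [set (0 : 'rV[R]_k)] = 1%N.
Proof. by rewrite /cut_count asboolT //; left. Qed.

Lemma cut0 (k : nat) (z : 'rV[R]_k) : cut [set 0] z = 0.
Proof. by rewrite /cut asboolF // => -[t -> /=]; rewrite crd0 ltxx. Qed.

Lemma stack_zero (k : nat) (S : set 'rV[R]_k.+1) :
  stack [set 0] (cut_count [set (0 : 'rV[R]_k)]) (fun _ => cut [set 0]) S ->
  S = [set 0] \/ exists s, S = lexcell k s.
Proof.
rewrite cut_count0 stack_onecut => -[] ->; [left|right|right].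
- by apply: section0; rewrite cut0.
- exists true; apply/seteqP; split=> z; rewrite /lexcell /sgn /= cut0 col'_eq0;
    by move=> [? ?]; split=> //; lra.
- exists false; apply/seteqP; split=> z; rewrite /lexcell /sgn /= cut0 col'_eq0;
    by move=> [? ?]; split=> //; lra.
Qed.

(** The cut over the origin creates the origin and the two cells whose first nonzero coordinate is
    the new one; every other stack is a full cylinder and keeps [i] and [s]. This stops at dimension
    3, since the next stack over {x > 0} is cut at f. *)
Lemma cells_lex (k : nat) (S : set 'rV[R]_k) : (k <= 3)%N -> cells k S ->
  S = [set 0] \/ exists i s, (i < k)%N /\ S = lexcell i s.
Proof.
elim: k S => [|k IH] S k3 /=.
  move=> ->; left; apply/seteqP; split=> z // _; exact: crd_inj.
move=> [T CT]; have [->|[i [s [ik ->]]]] := IH _ (ltnW k3) CT.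
  by move/stack_zero => [->|[s ->]]; [left|right; exists k, s].
have -> : cut_count (lexcell i s : set 'rV[R]_k) = 0%N.
  rewrite /cut_count asboolF // => -[/notin_lexcell0//|[k3']].
  by rewrite k3' in k3.
rewrite stack_nocut => ->; right; exists i, s; split; first exact: leqW.
exact: lexcellS.
Qed.

Lemma lexcell_pos (k : nat) :
  (lexcell 0 false : set 'rV[R]_k) = [set z | 0 < crd z 0].
Proof.
by apply/seteqP; split=> z; rewrite /lexcell /= mul1r => //; case.
Qed.

Definition e1 k : 'rV[R]_k := mkrow k (fun n => (n == 0%N)%:R).

Lemma crd_e1 k : crd (e1 k.+1) 0 = 1. Proof. by rewrite crd_mkrow. Qed.

Lemma cut_count_pos : cut_count (lexcell 0 false : set 'rV[R]_3) = 1%N.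
Proof.
rewrite /cut_count asboolT //; right; split=> //; exists (e1 3).
  by rewrite lexcell_pos /= crd_e1.
by rewrite crd_e1.
Qed.

Lemma cut_pos k z :
  cut (lexcell 0 false : set 'rV[R]_k.+1) z = a * quad z / crd z 0.
Proof.
by rewrite /cut asboolT // lexcell_pos; exists (e1 k.+1); rewrite /= crd_e1.
Qed.

Lemma quad_col' (z : 'rV[R]_4) : quad (col' ord_max z) = quad z.
Proof. by rewrite /quad !crd_col'. Qed.

Lemma graphE : section (lexcell 0 false) (cut (lexcell 0 false)) = graph a.
Proof.
apply/seteqP; split=> z; rewrite /section /graph /= cut_pos lexcell_pos /=;
  rewrite crd_last quad_col' crd_col' // => -[x0 e]; split=> //.
  by rewrite e mulrC divfK // gt_eqF.
by rewrite -e mulrC mulKf // gt_eqF.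
Qed.

(** The condition [(i == 0%N) ==> s] excludes {x > 0}, which the last three cells replace. *)
Variant cell4 : set 'rV[R]_4 -> Prop :=
| Cell4_zero : cell4 [set 0]
| Cell4_lex i s : (i < 4)%N -> (i == 0%N) ==> s -> cell4 (lexcell i s)
| Cell4_below : cell4 (below a)
| Cell4_graph : cell4 (graph a)
| Cell4_above : cell4 (above a).

Lemma cells4 S : cells 4 S -> cell4 S.
Proof.
move=> [T CT]; have [->|[i [s [i3 ->]]]] := cells_lex (leqnn 3) CT.
  by move/stack_zero => [->|[s ->]]; [exact: Cell4_zero|exact: Cell4_lex].
case: (boolP ((i == 0%N) ==> s)) => [is_|].
  have -> : cut_count (lexcell i s : set 'rV[R]_3) = 0%N.
    rewrite /cut_count asboolF // => -[/notin_lexcell0//|[_ [z [z0 zi] x0]]].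
    move: is_ zi; case: i z0 {i3} => [_ /= ->|i z0 _ _]; first by rewrite /sgn; lra.
    by move: x0; rewrite z0 // ltxx.
  by rewrite stack_nocut lexcellS // => ->; apply: Cell4_lex => //; exact: leqW.
rewrite negb_imply => /andP[/eqP -> /negbTE ->].
rewrite cut_count_pos stack_onecut => -[] ->.
- by rewrite graphE; exact: Cell4_graph.
- suff -> : [set z : 'rV[R]_4 | lexcell 0 false (col' ord_max z) /\
      crd z 3 < cut (lexcell 0 false) (col' ord_max z)] = below a by exact: Cell4_below.
  apply/seteqP; split=> z; rewrite /below /= cut_pos quad_col' lexcell_pos /= crd_col' //;
    by move=> -[x0]; rewrite ltr_pdivlMr // [crd z 3 * _]mulrC; split.
- suff -> : [set z : 'rV[R]_4 | lexcell 0 false (col' ord_max z) /\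
      cut (lexcell 0 false) (col' ord_max z) < crd z 3] = above a by exact: Cell4_above.
  apply/seteqP; split=> z; rewrite /above /= cut_pos quad_col' lexcell_pos /= crd_col' //;
    by move=> -[x0]; rewrite ltr_pdivrMr // [crd z 3 * _]mulrC; split.
Qed.

Lemma cells_zero k : cells k [set 0].
Proof.
elim: k => [|k IH] /=; first by apply/seteqP; split=> z // _; exact: crd_inj.
exists [set 0] => //; rewrite cut_count0 stack_onecut; apply: Or31.
by rewrite section0 // cut0.
Qed.

Lemma cells_pos k : (k < 3)%N -> cells k.+1 (lexcell 0 false).
Proof.
elim: k => [_|k IH k3].
  exists [set 0]; first exact: cells_zero.
  rewrite cut_count0 stack_onecut; apply: Or33; rewrite lexcell_pos.
  apply/seteqP; split=> z /=; rewrite cut0; last by case.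
  by split=> //; exact: crd_inj.
exists (lexcell 0 false); first exact: IH (ltnW k3).
have -> : cut_count (lexcell 0 false : set 'rV[R]_k.+1) = 0%N.
  rewrite /cut_count asboolF // => -[/notin_lexcell0//|[k3']].
  by rewrite k3' in k3.
by rewrite stack_nocut lexcellS.
Qed.

Lemma cells_graph : cells 4 (graph a).
Proof.
exists (lexcell 0 false); first exact: cells_pos.
by rewrite cut_count_pos stack_onecut; apply: Or31; rewrite graphE.
Qed.

Lemma cells_cover k (z : 'rV[R]_k) : exists2 S, cells k S & S z.
Proof.
elim: k z => [|k IH] z; first by exists setT.
have [T CT Tz] := IH (col' ord_max z).
have : (cut_count T <= 1)%N by exact: leq_b1.
case E : (cut_count T) => [|[|//]] _.
  exists [set t | T (col' ord_max t)] => //=; exists T => //.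
  by rewrite E stack_nocut.
have [lt|gt|eq] := ltgtP (crd z k) (cut T (col' ord_max z)).
- exists [set t | T (col' ord_max t) /\ crd t k < cut T (col' ord_max t)] => //=.
  by exists T => //; rewrite E stack_onecut; exact: Or32.
- exists [set t | T (col' ord_max t) /\ cut T (col' ord_max t) < crd t k] => //=.
  by exists T => //; rewrite E stack_onecut; exact: Or33.
- exists (section T (cut T)); last by split=> //; rewrite crd_last.
  by exists T => //; rewrite E stack_onecut; exact: Or31.
Qed.

Lemma finite_cells k : finite_set (cells k).
Proof.
elim: k => [|k IH] /=; first exact: finite_set1.
apply: bigcup_finite => // T _; rewrite /stack finite_setU; split;
  apply: finite_image; apply: (@sub_finite_set _ _ `I_(cut_count T).+1) => //.
by move=> j /= /andP[].
Qed.

Lemma is_cad_cells : is_cad 4 cells.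
Proof.
split=> //.
  exists 1%N, (fun _ => 0); split=> [j _|i j i0 ij j1|].
  - exact: algebraic0.
  - by move: (leq_trans ij j1); rewrite ltnNge i0.
  - have e : [set: 'rV[R]_0] = [set 0].
      by apply/seteqP; split=> z // _; exact: crd_inj.
    rewrite /= bigcup_set1 e cut_count0; congr stack.
    by apply/funext => j; apply/funext => z; rewrite cut0.
move=> k k1 k4; exists (@cut_count k), (fun S _ => cut S); split=> // S CS.
split; last first.
  move=> i j i1 ij jS; exfalso.
  have := leq_trans (leq_ltn_trans i1 ij) (leq_trans jS (leq_b1 _)).
  by rewrite ltnn.
move=> j; have [->|[i [s [ik ->]]]] := cells_lex k4 CS => jc.
  split; first exact: continuous_subspace1.
  by rewrite section0 ?cut0 //; exact: semialgebraic0.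
(* A cell without the origin carries a cut only for [k = 3] and if it has a point with x > 0; this
   forces [i = 0] and the positive sign. *)
have : (0 < cut_count (lexcell i s : set 'rV[R]_k))%N by case/andP: jc; exact: leq_trans.
rewrite lt0b => /asboolP[/notin_lexcell0//|[k3 [z [z0 zi] x0]]].
subst k; case: i ik z0 zi {jc CS} => [_ _|i _ z0]; last first.
  by move: x0; rewrite z0 // ltxx.
case: s => [|_]; first by rewrite /sgn; lra.
split; last first.
  rewrite graphE.
  have -> : graph a = [set z : 'rV[R]_4 | 0 < mpoly.meval (z ord0) (pcrd R 4 0)] `&`
     [set z | mpoly.meval (z ord0) (pcrd R 4 0 * pcrd R 4 3 -
        (a *: (pcrd R 4 1 * pcrd R 4 1 + pcrd R 4 2 * pcrd R 4 2))) = 0].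
    apply/seteqP; split=> t; rewrite /graph /quad /=;
      rewrite mpoly.mevalB mpoly.mevalZ mpoly.mevalD !mpoly.mevalM !meval_pcrd !expr2;
      move=> [x1 h]; split=> //; lra.
  by apply: semialgebraicI; [exact: semialgebraic_gt0|exact: semialgebraic_eq0].
have -> : cut (lexcell 0 false) = (fun z : 'rV[R]_3 => a * quad z / crd z 0).
  by apply/funext => t; rewrite cut_pos.
apply: continuous_in_subspaceT => t; rewrite inE lexcell_pos /= => t0.
by continuity; rewrite gt_eqF.
Qed.

End cells.
Arguments cells {R} a k.

(** * Frontier condition and closure finiteness *)

Section closure_finiteness.
Context (R : realType) (a : R).
Hypothesis a0 : 0 < a.

Lemma lexcell_nonpos (i : nat) s (z : 'rV[R]_4) :
  (i == 0%N) ==> s -> lexcell i s z -> crd z 0 <= 0.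
Proof.
case: i => [/= -> [_]|i _ [z0 _]]; first by rewrite /sgn; lra.
by rewrite z0.
Qed.

(** The sign of x is constant on such a cell and never positive, so one point with x >= 0 puts the
    whole cell in x = 0. *)
Lemma lexcell_eq0 (i : nat) s (p q : 'rV[R]_4) :
  (i == 0%N) ==> s -> lexcell i s p -> lexcell i s q -> 0 <= crd p 0 ->
  crd p 0 = 0 /\ crd q 0 = 0.
Proof.
case: i => [/= -> [_]|i _ [p0 _] [q0 _] _]; last by rewrite p0 ?q0.
by rewrite /sgn; lra.
Qed.

(** A point of [abovecl a] with x <= 0 has x = y = z = 0 and w >= 0. Its first nonzero coordinate
    can then only be w > 0, so the cell is the open half-axis. *)
Lemma lexcell_abovecl (i : nat) s (p q : 'rV[R]_4) : (i < 4)%N ->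
  (i == 0%N) ==> s -> lexcell i s p -> lexcell i s q -> abovecl a p ->
  [/\ crd q 0 = 0, quad q = 0 & 0 <= crd q 3].
Proof.
move=> i4 is_ Sp Sq pcl; case: (pcl) => x0 w0 _.
have [p0 q0] := lexcell_eq0 is_ Sp Sq x0.
have [_ p1 p2] : [/\ crd p 0 = 0, crd p 1 = 0 & crd p 2 = 0].
  by apply: boundary_point pcl => //; rewrite p0.
case: i i4 {is_} Sp Sq => [|[|[|[|//]]]] _ [_ ps] [qz qs];
  move: ps; rewrite ?p0 ?p1 ?p2 ?mulr0 ?ltxx // => ps.
split=> //; first by rewrite /quad !qz // expr0n addr0.
by move: ps qs; rewrite /sgn; case: s; lra.
Qed.

Lemma cell4_frontier (D S : set 'rV[R]_4) (p q : 'rV[R]_4) :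
  cell4 a D -> cell4 a S -> S p -> S q -> closure D p -> closure D q.
Proof.
case=> [|i s i4 is_|||].
- have -> : closure [set (0 : 'rV[R]_4)] = [set 0].
    apply/esym/closure_id/accessible_closed_set1/hausdorff_accessible.
    exact: norm_hausdorff.
  case=> [|j t j4 _|||] //= Sp Sq p0; move: Sp; rewrite p0.
  + by move/notin_lexcell0.
  + by case; rewrite crd0 ltxx.
  + by case; rewrite crd0 ltxx.
  + by case; rewrite crd0 ltxx.
- rewrite closure_lexcell // => cS Sp Sq [p0 pi].
  (* Since {x > 0} is excluded, this closure lies in x <= 0 and misses the three cells over x >
     0. *)
  have x_le0 : crd p 0 <= 0.
    case: i i4 is_ p0 pi => [|i] _ /=; first by move=> ->; rewrite /sgn; lra.
    by move=> _ /(_ 0%N isT) ->.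
  case: cS Sp Sq => [|j t j4 _|[]|[]|[]]; [| |lra|lra|lra].
    by move=> _ ->; split=> *; rewrite ?crd0 ?mulr0.
  (* As [p] vanishes before [i], its first nonzero index [j] is at least [i]; the signs matter only
     if [j = i], and then they agree. *)
  move=> [p0' pj] [q0 qj]; have ij : (i <= j)%N.
    by rewrite leqNgt; apply/negP => ji; move: pj; rewrite p0 // mulr0 ltxx.
  split=> [n ni|]; first by apply: q0; exact: leq_trans ij.
  move: ij; rewrite leq_eqVlt => /orP[/eqP ij|ij]; last by rewrite q0 // mulr0.
  by subst j; move: pj pi qj; rewrite /sgn; case: s {is_}; case: t; lra.
- rewrite closure_below //; case=> [|j t j4 jt|||] /=; rewrite /belowcl /=.
  + by move=> -> ->.
  + move=> Sp Sq [x0 _]; have [_ ->] := lexcell_eq0 jt Sp Sq x0.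
    by rewrite mul0r mulr_ge0 ?quad_ge0 // ltW.
  + by move=> _ [/ltW ? /ltW ?].
  + by move=> _ [/ltW ? ->].
  + by move=> [_ pa] _ [_]; rewrite leNgt pa.
- rewrite closure_graph //; case=> [|j t j4 jt|||] /=; rewrite /graphcl /=.
  + by move=> -> ->.
  + move=> Sp Sq [x0 w0 xw].
    have [|-> -> w] := lexcell_abovecl j4 jt Sp Sq; first by split=> //; rewrite xw.
    by split=> //; rewrite mul0r mulr0.
  + by move=> [_ pa] _ [_ _ e]; move: pa; rewrite e ltxx.
  + move=> _ Sq _; have := subset_closure Sq; rewrite closure_graph //.
  + by move=> [_ pa] _ [_ _ e]; move: pa; rewrite e ltxx.
- rewrite closure_above //; case=> [|j t j4 jt|||] /=; rewrite /abovecl /=.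
  + by move=> -> ->.
  + move=> Sp Sq pcl.
    have [//|-> -> w] := lexcell_abovecl j4 jt Sp Sq.
    by split=> //; rewrite mul0r mulr0.
  + by move=> [_ pa] _ [_ _]; rewrite leNgt pa.
  + move=> _ Sq _; have := subset_closure Sq; rewrite closure_graph //.
    by case=> ? ? ->.
  + by move=> _ Sq _; have := subset_closure Sq; rewrite closure_above.
Qed.

End closure_finiteness.

(** Each point of [closure D] lies in some cell, which the frontier condition puts inside
    [closure D]; the finitely many cells contained in the closure therefore fill it. *)
Lemma finite_union_closure_finite (R : realType) (n : nat)
    (P : set (set 'rV[R]_n)) : finite_set P ->
  (forall z, exists2 S, P S & S z) ->
  (forall D S p q, P D -> P S -> S p -> S q -> closure D p -> closure D q) ->
  closure_finite P.
Proof.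
move=> finP covP frontier D PD.
have : finite_set (P `&` [set S | S `<=` closure D]) by exact: finite_setIl.
move=> /finite_seqP[s sE]; exists (size s), (fun i => nth set0 s i).
have mem S : S \in s <-> P S /\ S `<=` closure D.
  by have : [set` s] S <-> (P `&` [set S | S `<=` closure D]) S by rewrite sE.
split=> [i|]; first by have [] := (mem (nth set0 s i)).1 (mem_nth _ (ltn_ord i)).
apply/seteqP; split=> z; last first.
  by move=> [i _ /((mem (nth set0 s i)).1 (mem_nth _ (ltn_ord i))).2].
move=> Dz; have [S PS Sz] := covP z.
have Ss : S \in s by apply/mem; split=> // q Sq; exact: frontier Sz Sq Dz.
have lt : (index S s < size s)%N by rewrite index_mem.
by exists (Ordinal lt) => //=; rewrite nth_index.
Qed.

(** * Failure of well-borderedness *)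

Lemma mkrow_continuous (R : realType) (T : topologicalType) (k : nat)
    (g : T -> nat -> R) (x : T) :
  (forall n, (n < k)%N -> continuous_at x (fun t => g t n)) ->
  continuous_at x (fun t => mkrow k (g t)).
Proof.
move=> cg; apply: cvg_crd => n nk; rewrite crd_mkrow //.
by under eq_fun do rewrite crd_mkrow //; exact: cg.
Qed.

Lemma within_continuous_comp_at (S T U : topologicalType) (B : set T)
    (p : S -> T) (h : T -> U) :
  (forall s, B (p s)) -> continuous p -> {within B, continuous h} ->
  continuous (h \o p).
Proof.
move=> Bp cp ch s.
have hs : h x @[x --> within B (nbhs (p s))] --> h (p s).
  by rewrite (nbhs_subspace_in (Bp s)); exact: ch.
apply: cvg_comp hs => A /cp cA.
by apply: filterS (cA : nbhs s [set t | B (p t) -> A (p t)]) => t /(_ (Bp t)).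
Qed.

(* The half circle and the diameter joining two opposite points meet only
   there, yet by the intermediate value theorem a real function takes the
   mean of its values at the two points on both. *)
Lemma planar_ball_not_line (R : realType) (n : nat) (E : set 'rV[R]_n)
    (h : 'rV[R]_n -> R) (c : 'rV[R]_2) (r : R) : 0 < r ->
  continuous h -> (forall x y, E x -> E y -> h x = h y -> x = y) ->
  ~ homeomorphic E (open_euclidean_ball c r).
Proof.
move=> r0 ch hinj [f [g [[_ cg] [_ gE] _ fg]]].
(* For t in [0, pi], [k = r / 2] gives the half circle and [k = 0] the diameter, with common ends at
   t = 0 and t = pi. The radius r / 2 keeps both inside the open ball. *)
pose arc k (t : R) : 'rV[R]_2 := mkrow 2 (nth 0
  [:: crd c 0 + r / 2 * cos t; crd c 1 + k * sin t]).
have arcE k t : (k = 0) \/ (k = r / 2) -> open_euclidean_ball c r (arc k t).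
  have -> : open_euclidean_ball c r (arc k t) =
      ((r / 2) ^+ 2 * cos t ^+ 2 + k ^+ 2 * sin t ^+ 2 < r ^+ 2) :> Prop.
    rewrite /open_euclidean_ball /= !big_ord_recl big_ord0 -!crdE !crd_mkrow //=.
    by congr (is_true (_ < _)); ring.
  move=> kE.
  have kr : k ^+ 2 <= (r / 2) ^+ 2.
    by case: kE => ->; rewrite // expr0n sqr_ge0.
  apply: (@le_lt_trans _ _ ((r / 2) ^+ 2 * (cos t ^+ 2 + sin t ^+ 2))).
    by rewrite mulrDr lerD2l ler_wpM2r ?sqr_ge0.
  by rewrite cos2Dsin2 mulr1 ltr_pXn2r ?nnegrE //; lra.
have arc_cont k : continuous (arc k).
  move=> t; apply: mkrow_continuous => -[|[|//]] _ /=; continuity.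
    exact: continuous_cos.
  exact: continuous_sin.
pose psi k t := h (g (arc k t)).
have psi_cont k : (k = 0) \/ (k = r / 2) -> continuous (psi k).
  move=> kE t; apply: (@continuous_comp _ _ _ (fun t => g (arc k t)) h); last exact: ch.
  exact: (within_continuous_comp_at (fun s => arcE k s kE) (arc_cont k) cg).
have psi_inj k l t u : (k = 0) \/ (k = r / 2) -> (l = 0) \/ (l = r / 2) ->
    psi k t = psi l u -> arc k t = arc l u.
  move=> kE lE e; have := hinj _ _ (gE _ (arcE k t kE)) (gE _ (arcE l u lE)) e.
  by move=> /(congr1 f); rewrite (fg _ (arcE k t kE)) (fg _ (arcE l u lE)).
have z0 : (0 : R) = 0 \/ (0 : R) = r / 2 by left.
have r2 : r / 2 = 0 \/ r / 2 = r / 2 by right.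
have arc_0 : arc (r / 2) 0 = arc 0 0.
  by congr mkrow; rewrite sin0 !mulr0.
have arc_pi : arc (r / 2) pi = arc 0 pi.
  by congr mkrow; rewrite sinpi !mulr0.
have mean k : (k = 0) \/ (k = r / 2) -> exists2 t, t \in `[0, pi]%R &
    psi k t = (psi 0 0 + psi 0 pi) / 2.
  move=> kE; apply: IVT; [exact: pi_ge0|exact: continuous_subspaceT (psi_cont k kE)|].
  have -> : psi k 0 = psi 0 0 by case: kE => [->//|->]; rewrite /psi arc_0.
  have -> : psi k pi = psi 0 pi by case: kE => [->//|->]; rewrite /psi arc_pi.
  by case: (leP (psi 0 0) (psi 0 pi)) => ?; lra.
have ends : psi 0 0 <> psi 0 pi.
  move=> /(psi_inj _ _ _ _ z0 z0)/(congr1 (fun z => crd z 0)).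
  by rewrite !crd_mkrow //= cos0 cospi; lra.
have [t tpi psit] := mean _ z0; have [u upi psiu] := mean _ r2.
have := psi_inj _ _ _ _ z0 r2 (etrans psit (esym psiu)).
move=> /(congr1 (fun z => crd z 1)); rewrite !crd_mkrow //= mul0r => e.
(* Where the two paths meet, the second coordinates give sin u = 0, so u is 0 or pi. An end value of
   [psi] would then equal the mean of both, against [ends]. *)
have su : sin u = 0.
  by apply: (@mulfI _ (r / 2)); [rewrite gt_eqF //; lra|lra].
move: upi psiu; rewrite in_itv /= => /andP[]; rewrite le_eqVlt => /orP[/eqP <- _|u0].
  by rewrite /psi arc_0; move: ends; rewrite /psi => ends ?; apply: ends; lra.
rewrite le_eqVlt => /orP[/eqP ->|upi _].
  by rewrite /psi arc_pi; move: ends; rewrite /psi => ends ?; apply: ends; lra.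
by have := @sin_gt0_pi _ u; rewrite su ltxx u0 upi => /(_ isT).
Qed.

(* The inversion with center (-1, 0, 0) maps {x > 0} onto an open ball (written
   here with the image translated by (1, 0, 0)). *)
Lemma graph_ball (R : realType) (a : R) : 0 < a ->
  topological_ball 3 (graph a).
Proof.
move=> a0; pose c : 'rV[R]_3 := mkrow 3 (nth 0 [:: 1 / 2; 0; 0]).
exists c, (1 / 2); split; first by lra.
(* The ball with center (1/2, 0, 0) and radius 1/2 is |u|^2 < u_0. *)
have ballE u : open_euclidean_ball c (1 / 2) u =
    (crd u 0 ^+ 2 + quad u < crd u 0) :> Prop.
  rewrite /open_euclidean_ball /quad /= !big_ord_recl big_ord0 -!crdE !crd_mkrow //=.
  by congr is_true; apply/idP/idP; rewrite /bump /=; lra.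
(* [N] is the squared distance of (x, y, z) from the center of inversion, and [M] the squared norm
   of the image; they are reciprocal. The last coordinate of the inverse map is f at the recovered
   point, where x = (u_0 - M) / M. *)
pose N (z : 'rV[R]_4) := (crd z 0 + 1) ^+ 2 + quad z.
pose M (u : 'rV[R]_3) := crd u 0 ^+ 2 + quad u.
exists (fun z => mkrow 3 (nth 0 [:: (crd z 0 + 1) / N z; crd z 1 / N z; crd z 2 / N z])).
exists (fun u => mkrow 4 (nth 0 [:: crd u 0 / M u - 1; crd u 1 / M u; crd u 2 / M u;
  a * quad u / (M u * (crd u 0 - M u))])).
have N0 z : graph a z -> 0 < N z.
  by move=> [x0 _]; rewrite /N; have := quad_ge0 z; nra.
have M0 u : open_euclidean_ball c (1 / 2) u -> 0 < M u < crd u 0.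
  rewrite ballE -/(M u) => Mu; rewrite Mu andbT.
  have := quad_ge0 u; move: Mu; rewrite /M; nra.
split; first split.
- apply: continuous_in_subspaceT => z; rewrite inE => /N0 Nz.
  apply: mkrow_continuous => -[|[|[|//]]] _; rewrite /= /N; continuity;
    by rewrite gt_eqF.
- apply: continuous_in_subspaceT => u; rewrite inE => /M0 /andP[Mu uM].
  apply: mkrow_continuous => -[|[|[|[|//]]]] _; rewrite /= /M; continuity;
    by rewrite ?mulf_neq0 // gt_eqF // subr_gt0.
- split=> [z Gz|u /M0 /andP[Mu uM]].
    have := N0 z Gz; case: Gz => x0 _ Nz.
    rewrite ballE /quad !crd_mkrow //= !expr_div_n -!mulrDl.
    rewrite ltr_pdivrMr ?exprn_gt0 // expr2 mulrA divfK ?gt_eqF //.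
    rewrite /N /quad in Nz *; nra.
  rewrite /graph /quad /= !crd_mkrow //=; split.
    by rewrite subr_gt0 ltr_pdivlMr // mul1r.
  have Mn : M u != 0 by rewrite gt_eqF.
  have uMn : crd u 0 - M u != 0 by rewrite gt_eqF // subr_gt0.
  by rewrite /quad; field; rewrite Mn uMn.
- move=> z Gz; have := N0 z Gz; case: Gz => x0 xw Nz.
  have Nn : N z != 0 by rewrite gt_eqF.
  have xn : crd z 0 != 0 by rewrite gt_eqF.
  have x1n : crd z 0 + 1 != 0 by rewrite gt_eqF //; lra.
  have Me : M (mkrow 3 (nth 0 [:: (crd z 0 + 1) / N z; crd z 1 / N z; crd z 2 / N z]))
      = (N z)^-1.
    rewrite /M /quad !crd_mkrow //= !expr_div_n addrA -!mulrDl -addrA.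
    by rewrite -/(quad z) -/(N z) expr2 invfM mulrA divff // mul1r.
  have wE : crd z 3 = a * quad z / crd z 0 by rewrite -xw mulrC mulKf.
  apply: crd_inj => -[|[|[|[|//]]]] _; rewrite crd_mkrow //= Me ?crd_mkrow //=.
  + by field.
  + by field.
  + by field.
  + rewrite wE /quad !crd_mkrow //=; field.
    by rewrite Nn xn.
- move=> u /M0 /andP[Mu uM].
  have Mn : M u != 0 by rewrite gt_eqF.
  set z := mkrow 4 _.
  have Ne : N z = (M u)^-1.
    rewrite /N /quad !crd_mkrow //= subrK !expr_div_n addrA -!mulrDl -addrA.
    by rewrite -/(quad u) -/(M u) expr2 invfM mulrA divff // mul1r.
  apply: crd_inj => -[|[|[|//]]] _; rewrite crd_mkrow //= Ne !crd_mkrow //= ?subrK;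
  by rewrite invrK divfK.
Qed.

Lemma cell_boundary_graph (R : realType) (a : R) : 0 < a ->
  cell_boundary (graph a) =
  [set z | [/\ crd z 0 = 0, crd z 1 = 0, crd z 2 = 0 & 0 <= crd z 3]].
Proof.
move=> a0; rewrite /cell_boundary closure_graph //; apply/seteqP; split=> z.
  move=> [[x0 w0 xw] ngz]; have x_le0 : crd z 0 <= 0.
    by rewrite leNgt; apply/negP => x_gt0; apply: ngz.
  by have [] := boundary_point (q := z) a0 x_le0; first by split=> //; rewrite xw.
move=> [z0 z1 z2 w0]; split; last by case; rewrite z0 ltxx.
by split; rewrite ?z0 // /quad z1 z2 expr0n addr0 mulr0 mul0r.
Qed.

Lemma cells_not_well_bordered (R : realType) (a : R) : 0 < a ->
  ~ well_bordered (cells a 4).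
Proof.
move=> a0 /(_ _ 3%N (cells_graph a) isT (graph_ball a0))[K [E [EP]]].
rewrite cell_boundary_graph // => bE.
(* The origin lies in the boundary, which rules out the empty union and supplies an actual 2-ball
   inside the ray. *)
have [i _ Ei0] : (\bigcup_i closure (E i)) 0 by rewrite -bE /= !crd0.
have [_ [c [r [r0]]]] := EP i.
apply: (planar_ball_not_line r0 (@crd_continuous R 4 3)) => x y Ex Ey xy.
have sub z : E i z -> [/\ crd z 0 = 0, crd z 1 = 0, crd z 2 = 0 & 0 <= crd z 3].
  move=> /subset_closure Ez.
  have : (\bigcup_i closure (E i)) z by exists i.
  by rewrite -bE.
have [x0 x1 x2 _] := sub x Ex; have [y0 y1 y2 _] := sub y Ey.
by apply: crd_inj => -[|[|[|[|//]]]] _; rewrite ?x0 ?x1 ?x2 ?y0 ?y1 ?y2.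
Qed.

(** On the vertical line over (1, 1, 0), f equals [a]. Off that height the line meets only [below a]
    and [above a], in open half-lines; a cell meeting the line in a single point thus reveals
    [a]. *)
Lemma cell4_fiber (R : realType) (a w : R) S : cell4 a S -> w != a ->
  S (mkrow 4 (nth 0 [:: 1; 1; 0; w])) ->
  exists2 w', w' != w & S (mkrow 4 (nth 0 [:: 1; 1; 0; w'])).
Proof.
move=> CS wa Sw; case: CS Sw => [|i s i4 is_|||].
- by move=> /(congr1 (fun z => crd z 0)); rewrite crd_mkrow //= crd0; lra.
- by move=> /(lexcell_nonpos is_); rewrite crd_mkrow //=; lra.
- move=> Sw; exists (w - 1); first by rewrite lt_eqF //; lra.
  by move: Sw; rewrite /below /quad /= !crd_mkrow //=; lra.
- by rewrite /graph /quad /= !crd_mkrow //= => -[_ e]; case/eqP: wa; lra.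
- move=> Sw; exists (w + 1); first by rewrite gt_eqF //; lra.
  by move: Sw; rewrite /above /quad /= !crd_mkrow //=; lra.
Qed.

Lemma cells_inj (R : realType) (a b : R) :
  cells a 4 = cells b 4 -> a = b.
Proof.
move=> ab; have := cells_graph a; rewrite ab => /cells4 Gb.
(* [graph a], as a cell of [cells b 4], meets the line over (1, 1, 0) only at height [a]; if [a]
   differed from [b], it would have a second point there. *)
apply/eqP/negPn/negP => /(cell4_fiber Gb)[|w /eqP wa].
  by rewrite /graph /quad /= !crd_mkrow //=; lra.
by rewrite /graph /quad /= !crd_mkrow //= => -[_ e]; apply: wa; lra.
Qed.

Theorem theorem2p2 (R : realType) :
  infinite_set [set P : set (set 'rV[R]_4) |
    [/\ cad P, closure_finite P & ~ well_bordered P]].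
Proof.
have pos (m : nat) : 0 < m.+1%:R :> R by rewrite ltr0n.
apply: (@sub_infinite_set _ [set cells (m.+1%:R : R) 4 | m in [set: nat]]).
  move=> _ [m _ <-]; split.
  - exists (cells (m.+1%:R : R)); last by []. exact: (is_cad_cells (m.+1%:R : R)).
  - apply: finite_union_closure_finite.
    + exact: finite_cells.
    + exact: cells_cover.
    + by move=> D S p q /cells4 cD /cells4 cS; exact: (cell4_frontier (pos m) cD cS).
  - exact: cells_not_well_bordered (pos m).
rewrite (eq_finite_set (inj_card_eq _)); first exact: infinite_nat.
move=> m n _ _ /cells_inj/eqP.
by rewrite eqr_nat => /eqP[].
Qed.
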